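(* Let $G$ be a chordal graph, $k$ a positive integer, and $D$ a $k$-optimal set in $G$. Then $G$ has a $k$-edge-chromatic subgraph in which every vertex of $V(G) - D$ has degree $k$.
   Context: Graphs are finite and simple. A vertex set $D$ is $k$-dependent if $G[D]$ has maximum degree at most $k-1$; $\phi_k(D) = k|D| - |E(G[D])|$; a $k$-optimal set is a $k$-dependent set maximizing $\phi_k$ over all $k$-dependent sets. A graph is $k$-edge-chromatic if its edges can be properly colored with at most $k$ colors. *)

(* Defs.v *)
From mathcomp Require Import all_boot all_order all_algebra.
Set Implicit Arguments.
Unset Strict Implicit.
Unset Printing Implicit Defensive.
Import Order.TTheory GRing.Theory Num.Theory.

Section Graphs.

Variable T : finType.

(* A finite simple graph with vertex type T is given by its adjacency
   relation e : rel T, required to be symmetric and irreflexive. *)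
Definition simple_graph (e : rel T) : Prop := symmetric e /\ irreflexive e.

Definition edges (e : rel T) : {set {set T}} :=
  [set [set p.1; p.2] | p in [set p : T * T | e p.1 p.2]].

Definition degree (e : rel T) (x : T) : nat := #|[set y | e x y]|.

(* The vertices outside D stay in T, as isolated vertices; the vertex set of
   the induced subgraph is D. *)
Definition induced (e : rel T) (D : {set T}) : rel T :=
  [rel x y | [&& x \in D, y \in D & e x y]].

Definition chordal (e : rel T) : Prop :=
  forall p : seq T, ucycle e p -> 4 <= size p ->
    exists x y : T,
      [/\ x \in p, y \in p, e x y, y != next p x & y != prev p x].

(* Maximum degree of G[D] at most k - 1; the subtraction is truncated, so this
   is meant for k > 0 only. *)
Definition k_dependent (e : rel T) (k : nat) (D : {set T}) : Prop :=
  forall x : T, x \in D -> degree (induced e D) x <= k - 1.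

Definition phi (e : rel T) (k : nat) (D : {set T}) : int :=
  ((k * #|D|)%N%:Z - #|edges (induced e D)|%:Z)%R.

Definition k_optimal (e : rel T) (k : nat) (D : {set T}) : Prop :=
  k_dependent e k D /\
  forall D' : {set T}, k_dependent e k D' -> (phi e k D' <= phi e k D)%R.

(* The graph with vertex set W and adjacency relation f is a subgraph
   (not necessarily induced or spanning) of the graph e. *)
Definition is_subgraph (W : {set T}) (f e : rel T) : Prop :=
  symmetric f /\ forall x y : T, f x y -> [&& x \in W, y \in W & e x y].

(* Only the colors of the edges of f matter; c is arbitrary on other sets. *)
Definition k_edge_chromatic (f : rel T) (k : nat) : Prop :=
  exists c : {set T} -> nat,
    (forall A : {set T}, A \in edges f -> c A < k) /\
    (forall A B : {set T}, A \in edges f -> B \in edges f ->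
       A != B -> A :&: B != set0 -> c A != c B).

End Graphs.

(* Main.v *)
Require Import Defs.
From mathcomp Require Import all_boot all_order all_algebra.
From mathcomp Require Import zify.
Set Implicit Arguments.
Unset Strict Implicit.
Unset Printing Implicit Defensive.
Import Order.TTheory GRing.Theory Num.Theory.

(* Let [U] be the complement of [D], ordered by a perfect elimination ordering.
   Each [x] in [U] gets [k] out-neighbors: the [k] later neighbors in [U]
   closest to [x], and, if there are only [b x < k] later ones, all of these
   and [k - b x] neighbors in [D]. The earlier neighbors of a vertex form a
   clique, so in-degrees inside [U] are at most [k]. The neighbors in [D] can
   be chosen with in-degrees at most [k]: [D] maximizes [phi] over all vertex
   sets, dependent or not, and a subset [S] of [U] spans at most
   [\sum_(x in S) b x] edges, which yields the required Hall condition.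
   By Konig's theorem the arcs have a [k]-coloring in which arcs with a common
   tail, or a common head, differ. The arcs are acyclic, so each color class is
   a union of directed paths leading from [U] to [D] and contains a matching
   covering [U]. *)

(** * Edge coloring of bipartite graphs *)

Section BipartiteEdgeColoring.

Variables A B : finType.
Implicit Types (E : {set A * B}) (c : A * B -> nat).

Definition proper_on E c :=
  {in E &, forall p q, c p = c q -> (p.1 = q.1 \/ p.2 = q.2) -> p = q}.

Lemma missing_color k (V : finType) (X : {set V}) (c : V -> nat) :
  #|X| < k -> exists2 i, i < k & forall v, v \in X -> c v <> i.
Proof.
move=> Xk; have [i ik iX] : exists2 i, i \in iota 0 k & i \notin map c (enum X).
  apply/hasP; rewrite has_predC; apply/negP => /allP sub.
  have := uniq_leq_size (iota_uniq 0 k) sub.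
  by rewrite size_iota size_map -cardE leqNgt Xk.
exists i; first by rewrite mem_iota in ik.
by move=> v Xv cv; case/negP: iX; rewrite -cv map_f // mem_enum.
Qed.

(* Kempe chains: the exchange of [a] and [b] on the edges ending in [Y], the
   set of right vertices reachable from [y0] by alternating a-b paths, frees
   [a] at [y0] without using it at [x0]. *)
Lemma konig_coloring k E :
  (forall x, #|[set p in E | p.1 == x]| <= k) ->
  (forall y, #|[set p in E | p.2 == y]| <= k) ->
  exists2 c, {in E, forall p, c p < k} & proper_on E c.
Proof.
elim: {E}#|E| {-2}E (erefl #|E|) => [|n IHn] E.
  move/eqP; rewrite cards_eq0 => /eqP-> _ _.
  by exists (fun=> 0) => p; rewrite inE.
move=> En dl dr; have /card_gt0P[[x0 y0] p0E] : 0 < #|E| by rewrite En.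
set p0 := (x0, y0) in p0E; pose E' := E :\ p0.
have E'n : #|E'| = n by move: (cardsD1 p0 E); rewrite p0E En => -[].
have sub (Q : pred (A * B)) :
    [set p in E' | Q p] \subset [set p in E | Q p].
  by apply/subsetP=> p; rewrite !inE => /andP[/andP[_ ->] ->].
have [||c ck cP] := IHn E' E'n.
- by move=> x; apply: leq_trans (dl x); exact/subset_leq_card/sub.
- by move=> y; apply: leq_trans (dr y); exact/subset_leq_card/sub.
have lt (Q : pred (A * B)) : Q p0 ->
    #|[set p in E' | Q p]| < #|[set p in E | Q p]|.
  move=> Qp0; apply/proper_card/properP; split; first exact: sub.
  by exists p0; rewrite !inE ?eqxx ?p0E.
have [a ak x0a] :=
  missing_color c (leq_trans (lt (fun p => p.1 == x0) (eqxx _)) (dl x0)).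
have [b bk y0b] :=
  missing_color c (leq_trans (lt (fun p => p.2 == y0) (eqxx _)) (dr y0)).
have {}x0a y : (x0, y) \in E' -> c (x0, y) <> a.
  by move=> p; apply: x0a; rewrite inE p /=.
have {}y0b x : (x, y0) \in E' -> c (x, y0) <> b.
  by move=> p; apply: y0b; rewrite inE p /=.
pose r y1 y2 := [exists x, [&& (x, y1) \in E', c (x, y1) == a,
                               (x, y2) \in E' & c (x, y2) == b]].
pose Y := [set y | connect r y0 y].
have lastY y : y \in Y -> y != y0 -> exists2 y1, y1 \in Y & r y1 y.
  rewrite inE => /connectP[s]; case/lastP: s => [|s z] /=.
    by move=> _ ->; rewrite eqxx.
  rewrite rcons_path last_rcons => /andP[ps rz] -> _.
  by exists (last y0 s) => //; rewrite inE; apply/connectP; exists s.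
(* As [b] is missing at [y0], such a [y] is not [y0], so it was reached by an alternating step whose
   [b]-edge ends in [y]. By properness this is the edge from [x], hence [x] also has an [a]-edge
   ending in [Y]. *)
have backY x y : (x, y) \in E' -> c (x, y) = b -> y \in Y ->
    exists y1, [/\ y1 \in Y, (x, y1) \in E' & c (x, y1) = a].
  move=> xyE xyb Yy; have [|y1 Yy1] := lastY y Yy.
    by apply: contra_eqN xyb => /eqP y0E; apply/eqP; move: xyE; rewrite y0E => /y0b.
  case/existsP=> x1 /and4P[x1y1 /eqP x1a x1y /eqP x1b].
  suff x1x : x1 = x by exists y1; rewrite -x1x.
  have := cP _ _ x1y xyE; rewrite x1b xyb => /(_ erefl (or_intror erefl)).
  by case.
have forthY x y y' : (x, y) \in E' -> c (x, y) = a -> (x, y') \in E' ->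
    c (x, y') = b -> y \in Y -> y' \in Y.
  move=> xy xya xy' xyb; rewrite !inE => yY; apply: (connect_trans yY).
  by apply/connect1/existsP; exists x; rewrite xy xya xy' xyb !eqxx.
pose sw i := if i == a then b else if i == b then a else i.
have sw_inj : injective sw.
  move=> i j; rewrite /sw.
  case: (eqVneq i a) => [->|/eqP ia]; case: (eqVneq j a) => [->|/eqP ja] //;
    do ?case: eqP => //; lia.
pose c1 p := if p.2 \in Y then sw (c p) else c p.
pose c2 p := if p == p0 then a else c1 p.
(* An edge at [x0] could turn to [a] only from [b], inside [Y]; [backY] would then give [x0] an edge
   already colored [a]. *)
have c1x0 y : (x0, y) \in E' -> c1 (x0, y) <> a.
  move=> yE; rewrite /c1 /=; case: ifP => [Yy|_]; last exact: x0a.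
  rewrite /sw; case: eqP => [ya|nya]; first by case: (x0a y).
  case: eqP => [yb _|//].
  by have [y1 [_ y1E y1a]] := backY _ _ yE yb Yy; case: (x0a y1).
have c1y0 x : (x, y0) \in E' -> c1 (x, y0) <> a.
  move=> xE; have Yy0 : y0 \in Y by rewrite inE connect0.
  rewrite /c1 /= Yy0 /sw; have := y0b _ xE.
  by do !case: eqP => //; lia.
have c1P : proper_on E' c1.
  (* Edges with a common right vertex are recolored together; a clash can only arise at a left
     vertex with one edge ending in [Y] and another outside. *)
  have mixed x y y' : (x, y) \in E' -> (x, y') \in E' -> y \in Y ->
      y' \notin Y -> sw (c (x, y)) <> c (x, y').
    move=> yE y'E Yy Yy'; rewrite /sw; case: eqP => [ya yb|_].
      by case/negP: Yy'; apply: forthY yE ya y'E _ Yy.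
    case: eqP => [yb ya|_ cc].
      have [y1 [Yy1 y1E y1a]] := backY _ _ yE yb Yy.
      have cc : c (x, y1) = c (x, y') by rewrite y1a.
      have [y1y'] := cP _ _ y1E y'E cc (or_introl erefl).
      by rewrite -y1y' Yy1 in Yy'.
    have [yy'] := cP _ _ yE y'E cc (or_introl erefl).
    by rewrite -yy' Yy in Yy'.
  move=> [x y] [x' y'] pE qE; rewrite /c1 /= => cc [] xx.
    rewrite -{x'}xx in qE cc *; move: cc; case: ifPn => Yy; case: ifPn => Yy' cc.
    - by apply: (cP _ _ pE qE (sw_inj _ _ cc)); left.
    - by case: (mixed x y y').
    - by case: (mixed x y' y).
    - by apply: (cP _ _ pE qE cc); left.
  rewrite -{y'}xx in qE cc *; move: cc; case: ifPn => _ cc.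
    by apply: (cP _ _ pE qE (sw_inj _ _ cc)); right.
  by apply: (cP _ _ pE qE cc); right.
have EE' p : p \in E -> p != p0 -> p \in E' by move=> pE pp; rewrite !inE pp.
exists c2 => [p pE|p q pE qE].
  rewrite /c2 /c1 /sw; case: eqP => [_ //|/eqP/(EE' p pE)/ck pk].
  by case: ifP => // _; do !case: ifP.
rewrite /c2; case: (eqVneq p p0) => [-> | pp0]; case: (eqVneq q p0) => [-> | qp0] //.
- have qE' := EE' q qE qp0; case: q qE' {qE qp0} => x y qE' /= cc [] xy.
    by move: qE' cc; rewrite -xy => /c1x0 ? /esym.
  by move: qE' cc; rewrite -xy => /c1y0 ? /esym.
- have qE' := EE' p pE pp0; case: p qE' {pE pp0} => x y qE' /= cc [] xy.
    by move: qE' cc; rewrite xy => /c1x0.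
  by move: qE' cc; rewrite xy => /c1y0.
exact: c1P (EE' _ pE pp0) (EE' _ qE qp0).
Qed.

End BipartiteEdgeColoring.
(** * Matchings from acyclic orientations *)

(** Membership of [x] depends only on predecessors, which have smaller rank, so [K] is built by
    recursion on [rk]. On a directed path it consists of every other vertex, starting with the
    first; below, the arcs of a color class play the role of vertices. *)
Lemma acyclic_kernel (T : finType) (r : rel T) (rk : T -> nat) :
  (forall z x, r z x -> rk z < rk x) ->
  exists K : {set T}, forall x, (x \in K) = ~~ [exists z in K, r z x].
Proof.
move=> r_rk.
have [n rk_n] : exists n, forall x, rk x < n.
  by exists (\max_x rk x).+1 => x; rewrite ltnS leq_bigmax.
suff [K KP] : exists K : {set T},
    forall x, rk x < n -> (x \in K) = ~~ [exists z in K, r z x].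
  by exists K => x; apply: KP.
elim: n {rk_n} => [|n [K KP]]; first by exists set0.
exists [set x | if rk x < n then x \in K
                else ~~ [exists z in K, (rk z < n) && r z x]].
have E x : rk x <= n ->
    [exists z in [set x | if rk x < n then x \in K
                else ~~ [exists z in K, (rk z < n) && r z x]], r z x] =
    [exists z in K, (rk z < n) && r z x].
  move=> xn; apply/exists_inP/exists_inP => -[z zK].
    move=> zx; have zn : rk z < n := leq_trans (r_rk _ _ zx) xn.
    by exists z; [rewrite inE zn in zK|rewrite zn].
  by move=> /andP[zn zx]; exists z => //; rewrite inE zn.
move=> x; rewrite ltnS => xn; rewrite E // inE; case: ifP => // x_lt_n.
rewrite KP //; congr (~~ _).
apply/exists_inP/exists_inP => -[z zK]; last by move=> /andP[_ zx]; exists z.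
by move=> zx; exists z; rewrite // zx (ltn_trans (r_rk _ _ zx) x_lt_n).
Qed.

(* Each color class of a proper coloring of the arcs is a disjoint union of
   directed paths, each ending outside [U]. Keeping every other arc of such a
   path, starting with its first one, covers all its vertices in [U]. *)
Lemma saturating_matchings (T : finType) (a : rel T) (rk : T -> nat)
    (U : {set T}) k :
  (forall x y, a x y -> x \in U) ->
  (forall x y, a x y -> y \in U -> rk x < rk y) ->
  (forall x, x \in U -> #|[set y | a x y]| = k) ->
  (forall y, #|[set x | a x y]| <= k) ->
  exists f : rel T,
    [/\ symmetric f, forall x y, f x y -> a x y || a y x,
        k_edge_chromatic f k & forall x, x \in U -> degree f x = k].
Proof.
move=> aU a_rk a_out a_in.
have a_asym x y : a x y -> a y x -> False.
  move=> xy yx; have := a_rk _ _ yx (aU _ _ xy); have := a_rk _ _ xy (aU _ _ yx).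
  by move=> /ltn_trans/[apply]; rewrite ltnn.
(* The arcs become the edges of a bipartite graph on two copies of [T], tails on the left and heads
   on the right; left degrees are [k] on [U] and 0 elsewhere. *)
have [|| c ck cP] := @konig_coloring T T k [set p | a p.1 p.2].
- move=> x; apply: (@leq_trans #|[set y | a x y]|).
    apply: leq_trans (leq_imset_card (pair x) _); apply: subset_leq_card.
    apply/subsetP=> -[x1 y]; rewrite !inE /= => /andP[xy /eqP xx].
    by apply/imsetP; exists y; rewrite ?inE -xx.
  have [xU|xU] := boolP (x \in U); first by rewrite a_out.
  rewrite (_ : [set y | _] = set0) ?cards0 //; apply/setP=> y; rewrite !inE.
  by apply/negP=> /aU; rewrite (negPf xU).
- move=> y; apply: leq_trans (a_in y).
  apply: leq_trans (leq_imset_card (pair^~ y) _); apply: subset_leq_card.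
  apply/subsetP=> -[x y1]; rewrite !inE /= => /andP[xy /eqP yy].
  by apply/imsetP; exists x; rewrite ?inE -yy.
have {}ck x y : a x y -> c (x, y) < k by move=> xy; apply: ck; rewrite inE.
have {}cP x y x' y' : a x y -> a x' y' -> c (x, y) = c (x', y') ->
    (x = x' \/ y = y') -> (x, y) = (x', y').
  by move=> xy xy'; apply: cP; rewrite inE.
have c_onto x i : x \in U -> i < k -> exists2 y, a x y & c (x, y) = i.
  move=> xU ik; pose s := [seq c (x, y) | y <- enum [set y | a x y]].
  have us : uniq s.
    rewrite map_inj_in_uniq ?enum_uniq // => y y'; rewrite !mem_enum !inE.
    by move=> xy xy' cc; have [] := cP _ _ _ _ xy xy' cc (or_introl erefl).
  have sub : {subset s <= iota 0 k}.
    by move=> j /mapP[y]; rewrite mem_enum inE mem_iota => /ck ? ->.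
  have ss : size (iota 0 k) <= size s by rewrite size_iota size_map -cardE a_out.
  have [_ sk] := uniq_min_size us sub ss.
  have : i \in s by rewrite sk mem_iota.
  by case/mapP=> y; rewrite mem_enum inE => xy ->; exists y.
pose r (p q : T * T) := [&& a p.1 p.2, a q.1 q.2, p.2 == q.1 & c p == c q].
have [|K KP] := acyclic_kernel (r := r) (rk := fun p => rk p.1).
  move=> p q /and4P[pa qa /eqP pq _]; rewrite -pq; apply: a_rk => //.
  by rewrite pq; apply: aU qa.
pose m x y := a x y && ((x, y) \in K).
have m_a x y : m x y -> a x y by case/andP.
have m_head z x y : m z x -> m x y -> c (z, x) = c (x, y) -> False.
  move=> /andP[zx zxK] /andP[xy]; rewrite KP => /exists_inP nK cc; apply: nK.
  by exists (z, x) => //; rewrite /r /= zx xy cc !eqxx.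
pose f x y := m x y || m y x.
pose col x y := if m x y then c (x, y) else c (y, x).
have col_tail x y : m x y -> col x y = c (x, y) by rewrite /col => ->.
have col_head x y : m y x -> col x y = c (y, x).
  by move=> yx; rewrite /col; case: ifP => // /m_a xy; case: (a_asym _ _ xy (m_a _ _ yx)).
have col_lt x y : f x y -> col x y < k.
  by case/orP=> xy; rewrite ?(col_tail _ _ xy) ?(col_head _ _ xy); apply/ck/m_a.
have col_inj x y y' : f x y -> f x y' -> col x y = col x y' -> y = y'.
  case/orP=> xy; case/orP=> xy'; rewrite ?(col_tail _ _ xy) ?(col_head _ _ xy);
    rewrite ?(col_tail _ _ xy') ?(col_head _ _ xy') => cc.
  - by case: (cP _ _ _ _ (m_a _ _ xy) (m_a _ _ xy') cc (or_introl erefl)).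
  - by case: (m_head _ _ _ xy' xy).
  - by case: (m_head _ _ _ xy xy').
  - by case: (cP _ _ _ _ (m_a _ _ xy) (m_a _ _ xy') cc (or_intror erefl)).
have col_onto x i : x \in U -> i < k -> exists2 y, f x y & col x y = i.
  move=> xU ik; have [y xy <-] := c_onto x i xU ik.
  have [xyK|] := boolP ((x, y) \in K).
    by exists y; rewrite /f ?col_tail // /m xy xyK.
  (* If the arc of color [i] leaving [x] is dropped, its predecessor on the path is kept, and that
     arc enters [x] with the same color. *)
  rewrite KP negbK => /exists_inP[[z x'] zK /and4P[/= zx _ /eqP x'x /eqP cc]].
  rewrite {x'}x'x in zK zx cc; have mzx : m z x by rewrite /m zx.
  by exists z; rewrite /f ?mzx ?orbT // col_head.
exists f; split.
- by move=> x y; rewrite /f orbC.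
- by move=> x y /orP[] /m_a ->; rewrite ?orbT.
(* Colorings live on sets, so the arc is recovered from its two ends; asymmetry of [a] makes it
   unique. The default 0 is met only on sets that are not edges of [f]. *)
- pose cc (A : {set T}) :=
    if [pick p | m p.1 p.2 && (A == [set p.1; p.2])] is Some p then c p else 0.
  have ccE x y : f x y -> cc [set x; y] = col x y.
    move=> fxy; rewrite /cc; case: pickP => [[u v] /andP[/= uv /eqP E]|none].
      have uE : u \in [set x; y] by rewrite E set21.
      have vE : v \in [set x; y] by rewrite E set22.
      move: uE vE; rewrite !inE.
      case/orP=> /eqP Eu; case/orP=> /eqP Ev; rewrite ?Eu ?Ev in uv *.
      - by case: (a_asym _ _ (m_a _ _ uv) (m_a _ _ uv)).
      - by rewrite col_tail.
      - by rewrite col_head.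
      - by case: (a_asym _ _ (m_a _ _ uv) (m_a _ _ uv)).
    case/orP: fxy => mxy; first by have := none (x, y); rewrite /= mxy eqxx.
    by have := none (y, x); rewrite /= mxy setUC eqxx.
  have edgeP A w : A \in edges f -> w \in A -> exists2 y, f w y & A = [set w; y].
    case/imsetP=> -[x y]; rewrite inE /= => fxy ->; rewrite !inE.
    case/orP=> /eqP->; first by exists y.
    by exists x; rewrite 1?setUC // /f orbC.
  exists cc; split=> [A AE|A B AE BE AB].
    case/imsetP: AE => -[x y]; rewrite inE /= => fxy ->.
    by rewrite ccE //; apply: col_lt.
  case/set0Pn=> w; rewrite inE => /andP[wA wB].
  have [y wy EA] := edgeP A w AE wA; have [y' wy' EB] := edgeP B w BE wB.
  rewrite EA EB !ccE //; apply: contra_neq AB => /(col_inj _ _ _ wy wy') yy'.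
  by rewrite EA EB yy'.
move=> x xU; pose s := [seq col x y | y <- enum [set y | f x y]].
have us : uniq s.
  rewrite map_inj_in_uniq ?enum_uniq // => y y'; rewrite !mem_enum !inE.
  exact: col_inj.
have : perm_eq s (iota 0 k).
  apply: uniq_perm (iota_uniq _ _) _ => // i; rewrite mem_iota /= add0n.
  apply/mapP/idP => [[y]|ik]; first by rewrite mem_enum inE => /col_lt ? ->.
  by have [y xy <-] := col_onto x i xU ik; exists y; rewrite ?mem_enum ?inE.
by move/perm_size; rewrite size_iota size_map -cardE.
Qed.

(** * Bipartite subgraphs with prescribed degrees *)

Section BipartiteDegrees.

Variables A B : finType.
Local Open Scope ring_scope.

Definition cut (E : {set A * B}) (S : {set A}) (R : {set B}) : nat :=
  #|[set p in E | (p.1 \in S) && (p.2 \notin R)]|.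

(** The max-flow min-cut condition for demands [t] on the left, capacities [c] on the right and unit
    capacities on the edges. Integer values let the demands drop below zero in the induction,
    without truncation. *)
Definition feasible (E : {set A * B}) (t : A -> int) (c : B -> int) :=
  [forall S : {set A}, forall R : {set B},
    \sum_(x in S) t x <= (cut E S R)%:Z + \sum_(y in R) c y].

Lemma cutE E S R :
  cut E S R = \sum_(p in E) ((p.1 \in S) && (p.2 \notin R) : nat).
Proof.
rewrite /cut -sum1_card big_mkcond [RHS]big_mkcond.
by apply: eq_bigr => p _; rewrite !inE; case: (p \in E).
Qed.

Lemma cutD1 (E : {set A * B}) p S R : p \in E ->
  cut E S R = ((p.1 \in S) && (p.2 \notin R) + cut (E :\ p) S R)%N.
Proof. by move=> pE; rewrite !cutE (big_setD1 p) ?pE. Qed.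

Lemma cut_submod E S1 S2 R1 R2 :
  (cut E (S1 :|: S2) (R1 :|: R2) + cut E (S1 :&: S2) (R1 :&: R2)
    <= cut E S1 R1 + cut E S2 R2)%N.
Proof.
rewrite !cutE -!big_split; apply: leq_sum => p _; rewrite !inE.
by do 2![case: (p.1 \in _)]; do 2![case: (p.2 \in _)].
Qed.

Lemma sumUI (V : finType) (f : V -> int) (S1 S2 : {set V}) :
  \sum_(x in S1 :|: S2) f x + \sum_(x in S1 :&: S2) f x =
  \sum_(x in S1) f x + \sum_(x in S2) f x.
Proof.
rewrite ![\sum_(x in _) f x]big_mkcond -!big_split; apply: eq_bigr => x _ /=.
rewrite !inE.
by case: (x \in S1); case: (x \in S2); rewrite ?addr0 ?add0r.
Qed.

Lemma sum_dec (V : finType) (f : V -> int) v (S : {set V}) :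
  \sum_(x in S) (f x - (x == v)%:Z) = \sum_(x in S) f x - (v \in S)%:Z.
Proof.
rewrite sumrB; congr (_ - _); case: (boolP (v \in S)) => vS.
  rewrite (big_setD1 v) //= eqxx big1 ?addr0 // => x.
  by rewrite !inE => /andP[/negPf->].
by rewrite big1 // => x xS; case: eqP => // xv; rewrite -xv xS in vS.
Qed.

(* An edge [p] may be discarded unless a tight pair [(S1, R1)] has
   [p.1 \in S1] and [p.2 \notin R1], and it may be kept unless a tight pair
   [(S2, R2)] has [p.1 \notin S2] and [p.2 \in R2]; submodularity of [cut],
   strict on [p], excludes both obstructions at once. *)
Lemma degree_constrained_subgraph E t c : feasible E t c ->
  exists2 F : {set A * B}, F \subset E &
    (forall x, t x <= #|[set p in F | p.1 == x]|%:Z) /\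
    (forall y, #|[set p in F | p.2 == y]|%:Z <= c y).
Proof.
elim: {E}#|E| {-2}E (erefl #|E|) t c => [|n IHn] E.
  move/eqP; rewrite cards_eq0 => /eqP-> t c feas.
  have H S R := forallP (forallP feas S) R.
  exists set0 => //; split=> [x|y].
    have := H [set x] set0; rewrite big_set1 big_set0 addr0.
    by move=> /le_trans; apply; rewrite lez_nat subset_leq_card //;
       apply/subsetP=> p; rewrite !inE.
  have := H set0 [set y]; rewrite big_set1 big_set0 cutE big_set0 add0r.
  rewrite (_ : [set p in _ | _] = set0) ?cards0 //.
  by apply/setP=> p; rewrite !inE.
move=> En t c feas; have /card_gt0P[p pE] : (0 < #|E|)%N by rewrite En.
have E'n : #|E :\ p| = n by move: (cardsD1 p E); rewrite pE En => -[].
have [f1|] := boolP (feasible (E :\ p) t c).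
  have [F FE Fdeg] := IHn _ E'n _ _ f1.
  by exists F => //; apply: subset_trans FE (subD1set _ _).
case/forallPn=> S1 /forallPn[R1]; rewrite -ltNge => lt1.
pose t' x := t x - (x == p.1)%:Z; pose c' y := c y - (y == p.2)%:Z.
have [f2|] := boolP (feasible (E :\ p) t' c').
  have [F FE [Ft Fc]] := IHn _ E'n _ _ f2.
  have pF : p \notin F by apply/negP=> /(subsetP FE); rewrite !inE eqxx.
  have degU (Q : pred (A * B)) :
      #|[set q in p |: F | Q q]| = (Q p + #|[set q in F | Q q]|)%N.
    rewrite (cardsD1 p) !inE eqxx /=; congr (_ + #|pred_of_set _|)%N.
    apply/setP=> q; rewrite !inE; case: eqP => //= ->.
    by rewrite (negPf pF).
  exists (p |: F).
    by rewrite subUset sub1set pE (subset_trans FE (subD1set _ _)).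
  split=> [x|y]; rewrite degU PoszD.
    by rewrite -lerBlDl [p.1 == x]eq_sym; exact: Ft.
  by rewrite -lerBrDl [p.2 == y]eq_sym; exact: Fc.
case/forallPn=> S2 /forallPn[R2]; rewrite -ltNge !sum_dec => lt2.
have H S R := forallP (forallP feas S) R.
have h1 := H S1 R1; have h2 := H S2 R2.
have hU := H (S1 :|: S2) (R1 :|: R2); have hI := H (S1 :&: S2) (R1 :&: R2).
have sT := sumUI t S1 S2; have sC := sumUI c R1 R2.
have sub := cut_submod (E :\ p) S1 S2 R1 R2.
(* Submodularity is used without [p], whose own contribution to each cut is made explicit here;
   every position of its ends is then contradictory by linear arithmetic. *)
rewrite !(cutD1 _ _ pE) in h1 h2 hU hI.
move: lt1 lt2 h1 h2 hU hI sT sC sub; rewrite !inE.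
do 2![case: (p.1 \in _)]; do 2![case: (p.2 \in _)] => /=; lia.
Qed.

End BipartiteDegrees.

(** * Perfect elimination orderings *)

Section Chordal.

Variables (T : finType) (e : rel T).
Hypotheses (e_simple : simple_graph e) (e_chordal : chordal e).

Let e_sym : symmetric e := e_simple.1.
Let e_irr : irreflexive e := e_simple.2.

Lemma next_split (q1 q2 : seq T) x y :
  uniq (q1 ++ x :: y :: q2) ->
  next (q1 ++ x :: y :: q2) x = y.
Proof.
move=> u; rewrite next_nth mem_cat inE eqxx orbT.
case: q1 u => [|z q1] /=; first by rewrite eqxx.
case/andP; rewrite mem_cat !inE !negb_or => /andP[_ /andP[zx _]].
rewrite cat_uniq (negPf zx) /= => /and3P[_ /norP[xq1 _] _].
by rewrite index_cat (negPf xq1) /= eqxx addn0 nth_cat ltnNge leqnSn /= subSnn.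
Qed.

(* A minimal path from [s] to [s'] through [C] would close up with [a] to a
   chordless cycle of length at least 4. *)
Lemma chordal_neighbors_adjacent (C : {set T}) a s s' p :
  (forall z, z \in C -> (z != a) && ~~ e a z) -> e a s -> e a s' ->
  path e s p -> last s p = s' ->
  (forall z, z \in p -> [|| z \in C, z == s | z == s']) ->
  s != s' -> e s s'.
Proof.
move=> Ca as_ as'; elim: {p}(size p).+1 {-2}p (ltnSn (size p)) => // n IHn p pn.
case/shortenP=> q pathq uq subq lastq inC ss'; apply: contraT => nss'.
have qC z : z \in s :: q -> [|| z \in C, z == s | z == s'].
  by rewrite inE => /predU1P[->|/subq/inC//]; rewrite eqxx orbT.
have qn : size q <= size p by apply: uniq_leq_size subq; case/andP: uq.
have aq : a \notin s :: q.
  apply/negP=> /qC /or3P[/Ca||]; first by rewrite eqxx.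
    by move/eqP=> E; rewrite -E e_irr in as_.
  by move/eqP=> E; rewrite -E e_irr in as'.
have ucyc : ucycle e (a :: s :: q).
  by rewrite /ucycle /= aq [_ && uniq q]uq rcons_path as_ pathq lastq e_sym as'.
have size_ge4 : 4 <= size (a :: s :: q).
  case: (q) pathq lastq => [_ /= E|y [|? ?] //=]; first by rewrite E eqxx in ss'.
  by rewrite andbT => + E; rewrite E (negPf nss').
have [x [y [xc yc exy ynx ypx]]] := e_chordal ucyc size_ge4.
have uniqc : uniq (a :: s :: q) by case/andP: ucyc.
have xny : x != next (a :: s :: q) y.
  by apply: contra_neq ypx => ->; rewrite prev_next.
(* On the cycle [a] is adjacent only to [s] and [s'], its cyclic neighbors, so no chord ends in
   [a]. *)
have anbr z : z \in a :: s :: q -> e a z -> z != next (a :: s :: q) a ->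
    a != next (a :: s :: q) z -> False.
  rewrite inE => /predU1P[->|/qC/or3P[/Ca/andP[_ /negPf->]//||]/eqP->].
  - by rewrite e_irr.
  - by rewrite /= !eqxx.
  have s'q : s' \in s :: q by rewrite -lastq mem_last.
  have s'c : s' \in a :: s :: q by rewrite inE s'q orbT.
  have as's : a != s' by apply: contraNneq aq => ->.
  have -> : next (a :: s :: q) s' = a; last by rewrite eqxx.
  (* As [s'] is the last entry, [next] returns the default of [nth], the head [a]. *)
  have idx : index s' (a :: s :: q) = (size q).+1.
    by rewrite -[a :: _]cat1s index_cat inE eq_sym (negPf as's) -lastq index_last.
  by rewrite next_nth s'c idx nth_default.
have shorter q' : path e s q' -> last s q' = s' -> {subset q' <= s :: q} ->
    size q' < size q -> False.
  move=> p' l' sub' lt'; move/negP: nss'; apply; apply: (IHn q') => //.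
    by rewrite -ltnS; apply: leq_trans pn; rewrite ltnS (leq_trans lt').
  by move=> z /sub'/qC.
(* A chord between two vertices of the path would shortcut it, and by induction [s] and [s'] would
   be adjacent. *)
have nochord q1 u q2 v : s :: q = q1 ++ u :: q2 -> v \in q2 -> e u v ->
    v != next (a :: s :: q) u -> False.
  move=> sq /splitPr vq2 euv; case: vq2 sq => -[|w q3] q4 sq.
    by rewrite sq -cat_cons next_split ?eqxx // cat_cons -sq.
  move=> _; have sub' : {subset q1 ++ [:: u, v & q4] <= s :: q}.
    move=> z; rewrite sq !(mem_cat, inE).
    by case/or4P=> -> //; rewrite ?orbT.
  case: q1 sq sub' => [|s1 q1] [] E1 E2 sub'.
    move: pathq lastq (shorter (v :: q4)); rewrite E2 E1 /= last_cat cat_path /=.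
    move=> /and4P[_ _ _ p4] l4; rewrite euv p4 size_cat /=; apply => //.
      by move=> z zq; rewrite -E2 -E1; apply: sub'; rewrite inE zq orbT.
    by clear; lia.
  move: pathq lastq (shorter (q1 ++ [:: u, v & q4])).
  rewrite E2 /= !(last_cat, cat_path, size_cat) /= last_cat cat_path /=.
  move=> /and5P[-> -> _ _ /andP[_ ->]] l4; rewrite euv !size_cat /=; apply => //.
    by move=> z zq; rewrite -E2; apply: sub'; rewrite inE zq orbT.
  by clear; lia.
move: xc yc; rewrite !inE => /predU1P[xa|xq].
  by rewrite xa in exy ynx xny; move=> yc; case: (anbr y yc exy ynx xny).
case/predU1P=> [ya|yq].
  rewrite ya in exy ynx xny; rewrite e_sym in exy.
  by case: (anbr x _ exy xny ynx); rewrite !inE xq orbT.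
have {}xq : x \in s :: q by [].
have {}yq : y \in s :: q by [].
exfalso.
have [q1 [q2 sq]] : exists q1 q2, s :: q = q1 ++ x :: q2.
  by case/splitPr: xq => q1 q2; exists q1, q2.
move: yq; rewrite sq mem_cat inE => /or3P[yq1|/eqP yx|yq2].
- have [r1 [r2 Eq]] : exists r1 r2, q1 = r1 ++ y :: r2.
    by case/splitPr: yq1 => r1 r2; exists r1, r2.
  rewrite Eq -catA in sq; apply: (nochord r1 y (r2 ++ x :: q2) x) => //.
    by rewrite mem_cat mem_head orbT.
  by rewrite e_sym.
- by rewrite yx e_irr in exy.
- exact: nochord sq yq2 exy ynx.
Qed.

Definition simplicial (U : {set T}) z :=
  z \in U /\ {in U &, forall x y, e z x -> e z y -> x != y -> e x y}.

(* Dirac: for a component [C] of [U] minus the closed neighborhood of [a], the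
   set [S] of vertices of [U] outside [C] with a neighbor in [C] is a clique;
   induction on [C :|: S] provides a simplicial vertex in [C]. *)
Lemma simplicial_off_neighborhood (U : {set T}) a b :
  a \in U -> b \in U -> b != a -> ~~ e a b ->
  exists z, [/\ simplicial U z, z != a & ~~ e a z].
Proof.
elim: {U}#|U|.+1 {-2}U (ltnSn #|U|) a b => // n IHn U Un a b aU bU ba nab.
pose W := [set z in U | (z != a) && ~~ e a z].
pose h x y := [&& x \in W, y \in W & e x y].
have h_sym : symmetric h.
  by move=> x y; rewrite /h e_sym; case: (x \in W); case: (y \in W).
have hc_sym : connect_sym h by exact: sym_connect_sym.
pose C := [set z | connect h b z].
have bW : b \in W by rewrite inE bU ba.
have CW z : z \in C -> z \in W.
  have stepW : forall p x, x \in W -> path h x p -> last x p \in W.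
    by elim=> //= y p IHp x _ /andP[/and3P[_ yW _] /IHp]; apply.
  by rewrite inE => /connectP[p hp ->]; apply: stepW.
have CWP z : z \in C -> [/\ z \in U, z != a & ~~ e a z].
  by move/CW; rewrite inE => /and3P[].
pose S := [set s in U | e a s && [exists c in C, e c s]].
have closed x y : x \in C -> y \in U -> e x y -> y \in C :|: S.
  move=> xC yU exy; rewrite !inE; case: (boolP (e a y)) => eay.
    by rewrite yU /=; apply/orP; right; apply/existsP; exists x; rewrite xC.
  have [_ _ nax] := CWP x xC; have ya : y != a.
    by apply: contraNneq nax => <-; rewrite e_sym.
  apply/orP; left; have := xC; rewrite inE => /connect_trans; apply.
  by apply/connect1; rewrite /h CW // exy andbT inE yU ya.
have cliqueS : {in S &, forall s s', s != s' -> e s s'}.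
  move=> s s'; rewrite !inE => /and3P[_ as_ /exists_inP[c cC cs]].
  move=> /and3P[_ as' /exists_inP[c' c'C c's']].
  have [p pp pc'] : exists2 p, path h c p & c' = last c p.
    apply/connectP; apply: (@connect_trans _ _ b); last by rewrite inE in c'C.
    by rewrite hc_sym; rewrite inE in cC.
  have pC : {subset c :: p <= C}.
    move=> z /(path_connect pp) cz; move: cC; rewrite !inE => bc.
    exact: connect_trans bc cz.
  apply: (@chordal_neighbors_adjacent C a s s' (rcons (c :: p) s')) => //.
  - by move=> z /CWP[_ -> ->].
  - rewrite rcons_cons /= e_sym cs rcons_path -pc' c's' andbT.
    by apply: sub_path pp => x y /and3P[].
  - by rewrite last_rcons.
  - move=> z; rewrite mem_rcons inE => /predU1P[->|/pC->//].
    by rewrite eqxx !orbT.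
pose U' := C :|: S.
have U'U : U' \subset U.
  by apply/subsetP=> z; rewrite in_setU => /orP[/CWP[]//|]; rewrite inE => /andP[].
have aU' : a \notin U'.
  by apply/negP; rewrite in_setU => /orP[/CWP[_ /eqP]//|]; rewrite inE e_irr andbF.
have U'n : #|U'| < n.
  rewrite -ltnS; apply: leq_trans Un; rewrite ltnS; apply: proper_card.
  by apply/properP; split=> //; exists a.
(* By [closed], a vertex of [C] has all its neighbors in [U] inside [U'], so being simplicial passes
   from [U'] to [U]. *)
have lift z : z \in C -> simplicial U' z ->
    exists z, [/\ simplicial U z, z != a & ~~ e a z].
  move=> zC [_ zP]; have [zU za naz] := CWP z zC; exists z; split=> //.
  by split=> // x y xU yU zx zy; apply: zP => //; apply: closed zC _ _.
have bC : b \in C by rewrite inE connect0.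
have CU' z : z \in C -> z \in U' by move=> zC; rewrite inE zC.
(* The vertex found from a non-adjacent pair [s], [u] is neither [s] nor adjacent to it, so it is
   outside the clique [S] and thus in [C]. *)
have [/exists_inP[s sS /exists_inP[u uU' /andP[us nsu]]]|S_univ] :=
  boolP [exists s in S, exists u in U', (u != s) && ~~ e s u].
  have sU' : s \in U' by rewrite in_setU sS orbT.
  have [z [zP zs nsz]] := IHn _ U'n _ _ sU' uU' us nsu.
  have [zU' _] := zP; move: (zU'); rewrite in_setU => /orP[zC|zS].
    exact: lift zC zP.
  by rewrite cliqueS // eq_sym in nsz.
have {}S_univ s u : s \in S -> u \in U' -> u != s -> e s u.
  move=> sS uU' us; apply: contraR S_univ => nsu; apply/exists_inP; exists s => //.
  by apply/exists_inP; exists u; rewrite ?us.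
have [/exists_inP[c cC /exists_inP[u uU' /andP[uc ncu]]]|C_univ] :=
  boolP [exists c in C, exists u in U', (u != c) && ~~ e c u].
  have [z [zP zc ncz]] := IHn _ U'n _ _ (CU' c cC) uU' uc ncu.
  have [zU' _] := zP; move: (zU'); rewrite in_setU => /orP[zC|zS].
    exact: lift zC zP.
  by rewrite e_sym S_univ ?CU' 1?eq_sym in ncz.
(* Now [U'] is a clique, so [b] itself will do. *)
apply: (lift b) => //; split=> [|x y xU' yU' _ _ xy]; first exact: CU'.
move: (xU'); rewrite in_setU => /orP[xC|xS]; last by rewrite S_univ // eq_sym.
apply: contraR C_univ => nxy; apply/exists_inP; exists x => //.
by apply/exists_inP; exists y; rewrite // eq_sym xy.
Qed.

Lemma simplicial_exists (U : {set T}) : U != set0 -> exists z, simplicial U z.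
Proof.
case/set0Pn=> z zU.
have [/exists_inP[a aU /exists_inP[b bU /andP[ba nab]]]|univ] :=
  boolP [exists a in U, exists b in U, (b != a) && ~~ e a b].
  by have [y []] := simplicial_off_neighborhood aU bU ba nab; exists y.
exists z; split=> // x y xU yU _ _ xy; apply: contraR univ => nxy.
apply/exists_inP; exists x => //; apply/exists_inP; exists y => //.
by rewrite eq_sym xy.
Qed.

(** A simplicial vertex gets the largest rank and the rest is ranked by induction. Ranks thus run
    against the order of removal, which is why the earlier neighbors form a clique. *)
Lemma perfect_elimination (U : {set T}) :
  exists2 rk : T -> nat, {in U &, injective rk} &
    {in U & &, forall v x y, rk x < rk v -> rk y < rk v ->
      e v x -> e v y -> x != y -> e x y}.
Proof.
suff [rk [_ ? ?]] : exists rk : T -> nat, [/\ {in U, forall x, rk x < #|U|},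
    {in U &, injective rk} &
    {in U & &, forall v x y, rk x < rk v -> rk y < rk v ->
      e v x -> e v y -> x != y -> e x y}] by exists rk.
elim: {U}#|U| {-2}U (erefl #|U|) => [|n IHn] U Un.
  move/eqP: Un; rewrite cards_eq0 => /eqP->.
  by exists (fun=> 0); split=> x; rewrite inE.
have [|z [zU zP]] := @simplicial_exists U; first by rewrite -card_gt0 Un.
have Uzn : #|U :\ z| = n by move: (cardsD1 z U); rewrite zU Un => -[].
have [rk [rkn rkI rkP]] := IHn _ Uzn.
pose rk' x := if x == z then n else rk x.
have rkU x : x \in U -> x != z -> rk x < n.
  by move=> xU xz; rewrite -Uzn; apply: rkn; rewrite !inE xz.
exists rk'; split.
- move=> x xU; rewrite /rk' Un ltnS; case: eqVneq => // xz; exact: ltnW (rkU x xU xz).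
- move=> x y xU yU; rewrite /rk'.
  case: (eqVneq x z) => [->|xz]; case: (eqVneq y z) => [->|yz] //.
  + by move=> E; have := rkU y yU yz; rewrite -E ltnn.
  + by move=> E; have := rkU x xU xz; rewrite E ltnn.
  + by apply: rkI; rewrite !inE ?xz ?yz.
move=> v x y vU xU yU; rewrite /rk'; case: (eqVneq v z) => [->|vz].
  by move=> _ _; apply: zP.
have vn := rkU v vU vz.
case: (eqVneq x z) => [_ nv|xz]; first by move: (ltn_trans vn nv); rewrite ltnn.
case: (eqVneq y z) => [_ _ nv|yz]; first by move: (ltn_trans vn nv); rewrite ltnn.
by apply: rkP; rewrite !inE ?vz ?xz ?yz.
Qed.

End Chordal.

(** Used twice: with [rk] it selects the nearest later neighbors of a vertex; with a constant rank
    it merely cuts a set down to [k] elements. *)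
Lemma initial_subset (T : finType) (rk : T -> nat) (k : nat) (B : {set T}) :
  exists P : {set T}, [/\ P \subset B, #|P| = minn k #|B| &
    forall y w, y \in P -> w \in B -> rk w < rk y -> w \in P].
Proof.
elim: k => [|k [P [PB Pk Pinit]]].
  by exists set0; rewrite sub0set cards0 min0n; split=> // y w; rewrite inE.
have [BP|/subsetPn[z0 z0B z0P]] := boolP (B \subset P).
  exists P; split=> //; have E : P = B by apply/eqP; rewrite eqEsubset PB.
  by move: Pk; rewrite E; lia.
have z0BP : z0 \in B :\: P by rewrite inE z0P.
have [z zBP zmin] : exists2 z, z \in B :\: P &
    forall w, w \in B :\: P -> rk z <= rk w.
  by case: (arg_minnP rk z0BP) => z zBP zmin; exists z.
move: (zBP); rewrite inE => /andP[zP zB].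
exists (z |: P); split.
- by rewrite subUset sub1set zB.
- have ltPB : #|P| < #|B|.
    by apply/proper_card/properP; split=> //; exists z.
  by rewrite cardsU1 zP; move: Pk ltPB; clear; lia.
move=> y w yP wB wy; rewrite inE; have [|wP] := boolP (w \in P).
  by rewrite orbT.
have {}zmin : rk z <= rk w by apply: zmin; rewrite inE wP.
move: yP; rewrite !inE => /predU1P[yz|yP].
  by move: wy; rewrite yz ltnNge zmin.
by rewrite (Pinit y w) in wP.
Qed.

(** * Optimal sets *)

Section Optimality.

Variables (T : finType) (e : rel T) (k : nat).
Hypothesis e_simple : simple_graph e.

Let e_sym : symmetric e := e_simple.1.
Let e_irr : irreflexive e := e_simple.2.

Lemma edges_inducedP (S A : {set T}) :
  reflect (exists x y, [/\ x \in S, y \in S, e x y & A = [set x; y]])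
          (A \in edges (induced e S)).
Proof.
apply: (iffP imsetP) => [[[x y]]|[x [y [xS yS xy ->]]]].
  by rewrite inE => /and3P[xS yS xy] ->; exists x, y.
by exists (x, y); rewrite // inE /induced /= xS yS.
Qed.

Lemma edges_inducedS (S A : {set T}) : S \subset A ->
  edges (induced e S) \subset edges (induced e A).
Proof.
move=> /subsetP SA; apply/subsetP=> X /edges_inducedP[x [y [xS yS xy ->]]].
by apply/edges_inducedP; exists x, y; rewrite !SA.
Qed.

Lemma card_edges_D1 (S : {set T}) x : x \in S ->
  #|edges (induced e (S :\ x))| + degree (induced e S) x
    <= #|edges (induced e S)|.
Proof.
move=> xS; pose star := [set [set x; y] | y in [set y | induced e S x y]].
have -> : degree (induced e S) x = #|star|.
  rewrite card_in_imset // => y y'; rewrite !inE /= => /and3P[_ _ xy] _ E.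
  have : y \in [set x; y'] by rewrite -E set22.
  by rewrite !inE => /orP[] /eqP // yx; rewrite yx e_irr in xy.
rewrite -cardsUI (_ : _ :&: _ = set0) ?cards0 ?addn0.
  apply: subset_leq_card; rewrite subUset edges_inducedS ?subD1set //=.
  apply/subsetP=> _ /imsetP[y + ->]; rewrite inE => /and3P[_ yS xy].
  by apply/edges_inducedP; exists x, y.
apply/setP=> A; rewrite !inE; apply/negP=> /andP[].
case/edges_inducedP=> u [v [uS vS _ ->]] /imsetP[y _ E].
have : x \in [set u; v] by rewrite E set21.
by rewrite !inE => /orP[] /eqP xE; rewrite -xE !inE eqxx in uS vS.
Qed.

(** Every edge of the union lies in [A], lies in [S], or joins [S] to [A]. An edge inside [S] is
    counted once, as a pair of increasing rank; injectivity ensures that no edge escapes. *)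
Lemma card_edges_setU (rk : T -> nat) (S A : {set T}) :
  {in S &, injective rk} ->
  #|edges (induced e (S :|: A))| <= #|edges (induced e A)| +
    (#|[set p | [&& p.1 \in S, p.2 \in S, e p.1 p.2 & rk p.1 < rk p.2]]| +
     #|[set p | [&& p.1 \in S, p.2 \in A & e p.1 p.2]]|).
Proof.
move=> rkI; set Q1 := [set p | _]; set Q2 := [set p | [&& _, _ & _]].
pose g (p : T * T) := [set p.1; p.2].
have sub : edges (induced e (S :|: A)) \subset
    edges (induced e A) :|: (g @: Q1 :|: g @: Q2).
  apply/subsetP=> X /edges_inducedP[x [y [xSA ySA xy ->]]]; rewrite in_setU.
  have inQ u v : e u v -> u \in S -> (v \in S) || (v \in A) ->
      [set u; v] \in g @: Q1 :|: g @: Q2.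
    move=> uv uS; rewrite in_setU; case/orP=> [vS|vA]; apply/orP; last first.
      by right; apply/imsetP; exists (u, v); rewrite // inE uS vA.
    left; case: (ltngtP (rk u) (rk v)) => [lt|lt|/(rkI u v uS vS) E].
    - by apply/imsetP; exists (u, v); rewrite // inE uS vS uv.
    - by rewrite setUC; apply/imsetP; exists (v, u); rewrite // inE uS vS e_sym uv.
    - by rewrite E e_irr in uv.
  move: xSA ySA; rewrite in_setU => xSA; rewrite in_setU => ySA.
  have [xS|xS] := boolP (x \in S); first by rewrite inQ ?orbT.
  have [yS|yS] := boolP (y \in S).
    by rewrite [[set x; y]]setUC inQ ?orbT // e_sym.
  rewrite (negPf xS) /= in xSA; rewrite (negPf yS) /= in ySA.
  by apply/orP; left; apply/edges_inducedP; exists x, y.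
apply: leq_trans (subset_leq_card sub) _; apply: leq_trans (leq_card_setU _ _) _.
rewrite leq_add2l; apply: leq_trans (leq_card_setU _ _) _.
exact: leq_add (leq_imset_card _ _) (leq_imset_card _ _).
Qed.

(* Deleting a vertex of degree at least [k] does not decrease [phi], so the
   maximum over all vertex sets is attained at a [k]-dependent set. *)
Lemma k_optimal_max (D : {set T}) : 0 < k -> k_optimal e k D ->
  forall S : {set T}, (phi e k S <= phi e k D)%R.
Proof.
move=> k_gt0 [_ Dmax] S; elim: {S}#|S| {-2}S (erefl #|S|) => [|n IHn] S Sn.
  apply: Dmax => x xS; move/eqP: Sn; rewrite cards_eq0 => /eqP S0.
  by rewrite S0 inE in xS.
have [/exists_inP[x xS degx]|dep] := boolP [exists x in S, k <= degree (induced e S) x].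
  have Sx : #|S| = #|S :\ x|.+1 by rewrite (cardsD1 x) xS.
  have Sx' : #|S :\ x| = n by move: Sx; rewrite Sn => -[].
  apply: le_trans (IHn _ Sx'); rewrite /phi Sx mulnS.
  by move: (card_edges_D1 xS) degx; clear; lia.
apply: Dmax => x xS; rewrite leqNgt; apply: contra dep => degx.
by apply/exists_inP; exists x => //; move: degx k_gt0; clear; lia.
Qed.

(* Compares [D] with [S' :|: D :\: R], where [S'] is the set of vertices of [S]
   with positive demand. *)
Lemma demand_feasible (D : {set T}) (rk : T -> nat) :
  0 < k -> k_optimal e k D -> {in ~: D &, injective rk} ->
  feasible [set p | [&& p.1 \notin D, p.2 \in D & e p.1 p.2]]
    (fun x => (if x \in D then 0 else
       k - #|[set y | [&& y \notin D, e x y & rk x < rk y]]|)%N%:Z%R)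
    (fun=> k%:Z%R).
Proof.
move=> k_gt0 Dopt rkI; set E := [set p | _].
pose B x := [set y | [&& y \notin D, e x y & rk x < rk y]].
apply/forallP=> S; apply/forallP=> R.
rewrite -!(big_morph Posz PoszD (erefl _)) sum_nat_const -PoszD lez_nat.
rewrite -[leqLHS]/(\sum_(x in S) (if x \in D then 0 else k - #|B x|)).
pose S' := [set x in S | (x \notin D) && (#|B x| < k)]; pose A := D :\: R.
have S'P x : x \in S' -> [/\ x \in S, x \notin D & #|B x| < k].
  by rewrite inE => /and3P[].
(* Stated additively because subtraction is truncated: vertices with at least [k] later neighbors
   demand nothing and drop out. *)
have sumS : \sum_(x in S) (if x \in D then 0 else k - #|B x|) +
    \sum_(x in S') #|B x| = k * #|S'|.
  have -> : \sum_(x in S) (if x \in D then 0 else k - #|B x|) =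
      \sum_(x in S') (k - #|B x|).
    rewrite big_mkcond [RHS]big_mkcond; apply: eq_bigr => x _.
    rewrite inE; case: (x \in S); case: (x \in D) => //=.
    by case: ltnP => // /eqP.
  rewrite -big_split /= mulnC -sum_nat_const; apply: eq_bigr => x /S'P[_ _ xk].
  by rewrite subnK // ltnW.
have le_phi := k_optimal_max k_gt0 Dopt (S' :|: A).
have cardSA : #|S' :|: A| = #|S'| + #|A|.
  rewrite -cardsUI (_ : S' :&: A = set0) ?cards0 ?addn0 //.
  by apply/setP=> x; rewrite !inE; case: (x \in D); rewrite ?andbF.
have cardDR : #|D| <= #|R| + #|A|.
  by rewrite -(cardsID R D) leq_add2r subset_leq_card ?subsetIr.
have mA := subset_leq_card (edges_inducedS (subsetDl D R)).
have rkI' : {in S' &, injective rk}.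
  by move=> x y /S'P[_ xD _] /S'P[_ yD _]; apply: rkI; rewrite inE.
have := card_edges_setU A rkI'.
set Q1 := [set p | _]; set Q2 := [set p | [&& _, _ & _]] => mSA.
have q1 : #|Q1| <= \sum_(x in S') #|B x|.
  apply: (@leq_trans #|[set p : T * T | (p.1 \in S') && (p.2 \in B p.1)]|).
    apply: subset_leq_card; apply/subsetP=> -[x y]; rewrite !inE /=.
    by case/and4P=> -> /and3P[_ -> _] -> ->.
  rewrite -sum1_card (eq_bigl (fun p : T * T => (p.1 \in S') && (p.2 \in B p.1))).
    rewrite -(pair_big_dep (mem S') (fun x y => y \in B x) (fun _ _ => 1)) /=.
    by apply: leq_sum => x _; rewrite sum1_card.
  by move=> p; rewrite inE.
have q2 : #|Q2| <= cut E S R.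
  apply: subset_leq_card; apply/subsetP=> p; rewrite !inE.
  by case/and3P=> /and3P[-> -> _] /andP[-> ->] ->.
have kDR : k * #|D| <= k * #|R| + k * #|A| by rewrite -mulnDr leq_mul2l cardDR orbT.
(* Optimality of [D] against [S' :|: A] yields [k * #|S'| <= k * #|R| + #|Q1| + #|Q2|]; by [q1] and
   [sumS], the term [#|Q1|] cancels. *)
move: le_phi; rewrite /phi cardSA mulnDr; rewrite -/A in mA.
move: sumS mA mSA q1 q2 kDR; rewrite [#|R| * k]mulnC; clear; lia.
Qed.

End Optimality.

(** * The orientation and the resulting subgraph *)

Theorem theorem6p3 (T : finType) (e : rel T) (k : nat) (D : {set T})
    (e_simple : simple_graph e) (e_chordal : chordal e) (k_gt0 : 0 < k)
    (D_opt : k_optimal e k D) :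
  exists (W : {set T}) (f : rel T),
    [/\ is_subgraph W f e,
        k_edge_chromatic f k
      & forall v : T, v \notin D -> v \in W /\ degree f v = k].
Proof.
have [e_sym e_irr] := e_simple.
have [rk rkI rkP] := perfect_elimination e_simple e_chordal (~: D).
have [F FE [Fdem Fcap]] :=
  degree_constrained_subgraph (demand_feasible e_simple k_gt0 D_opt rkI).
pose B x := [set y | [&& y \notin D, e x y & rk x < rk y]].
have [P PP] := fin_all_exists (fun x => initial_subset rk k (B x)).
have PB x y : y \in P x -> [/\ y \notin D, e x y & rk x < rk y].
  by have [/subsetP sub _ _] := PP x; move=> /sub; rewrite inE => /and3P[].
have FP x y : (x, y) \in F -> [/\ x \notin D, y \in D & e x y].
  by move=> /(subsetP FE); rewrite inE => /and3P[].
pose N x := P x :|: [set y | (x, y) \in F].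
(* [F] meets the demands only as lower bounds, so for [x] outside [D] the set [N x] may have more
   than [k] elements; [O x] keeps exactly [k]. *)
have [O OP] := fin_all_exists (fun x => initial_subset (fun=> 0) k (N x)).
pose a x y := (x \notin D) && (y \in O x).
have aN x y : a x y -> (y \in P x) || ((x, y) \in F).
  by have [/subsetP sub _ _] := OP x; move=> /andP[_ /sub]; rewrite !inE.
have a_e x y : a x y -> e x y.
  by case/aN/orP=> [/PB[]|/FP[]].
(* Let [x] be the earliest tail of an arc into [v]. The other tails are earlier neighbors of [v],
   hence adjacent to [x], and lie between [x] and [v]. As [P x] is initial and contains [v], it
   contains them too, so with [v] in place of [x] the tails number at most [#|P x|]. *)
have Pin v : v \notin D -> #|[set x | (x \notin D) && (v \in P x)]| <= k.
  move=> vD; set X := [set x | _].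
  have [->|[x0 x0X]] := set_0Vmem X; first by rewrite cards0.
  have [x xX xmin] : exists2 x, x \in X & forall y, y \in X -> rk x <= rk y.
    by case: (arg_minnP rk x0X) => z zX zmin; exists z.
  have [_ Pk Pinit] := PP x.
  move: (xX); rewrite inE => /andP[xD vx]; have [_ xv lt_xv] := PB _ _ vx.
  have Xsub : v |: (X :\ x) \subset P x.
    apply/subsetP=> y; rewrite in_setU1 => /predU1P[->//|].
    rewrite in_setD1 => /andP[yx yX]; move: (yX); rewrite inE => /andP[yD vy].
    have [_ yv lt_yv] := PB _ _ vy.
    have lt_xy : rk x < rk y.
      rewrite ltn_neqAle xmin // andbT; apply: contra_neq yx => /esym.
      by apply: rkI; rewrite inE.
    apply: (Pinit v) => //; rewrite inE yD lt_xy andbT /=.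
    by apply: (rkP v x y); rewrite ?inE // 1?e_sym // eq_sym.
  have vX : v \notin X :\ x.
    by rewrite !inE; apply/negP=> /and3P[_ _ /PB[_]]; rewrite e_irr.
  have := subset_leq_card Xsub; rewrite cardsU1 vX Pk (cardsD1 x X) xX.
  by move/leq_trans; apply; apply: geq_minl.
have [||||f [f_sym f_a f_chr f_deg]] := @saturating_matchings T a rk (~: D) k.
- by move=> x y /andP[xD _]; rewrite inE.
- move=> x y /aN/orP[/PB[] //|/FP[_ yD _]]; by rewrite inE yD.
- move=> x; rewrite inE => xD.
  have -> : [set y | a x y] = O x by apply/setP=> y; rewrite inE /a xD.
  have [_ -> _] := OP x; apply/minn_idPl.
  have := Fdem x; rewrite (negPf xD) lez_nat -/(B x).
  have -> : #|[set p in F | p.1 == x]| = #|[set y | (x, y) \in F]|.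
    rewrite -(card_imset [set y | (x, y) \in F] (_ : injective (pair x))) => [|y y' []//].
    apply/eq_card=> -[x' y]; rewrite inE; apply/andP/imsetP => [[xyF /eqP/= xx]|].
      by exists y; rewrite ?inE -xx.
    by case=> y'; rewrite inE => xyF [-> ->].
  have -> : #|N x| = #|P x| + #|[set y | (x, y) \in F]|.
    rewrite -cardsUI (_ : _ :&: _ = set0) ?cards0 ?addn0 //.
    apply/setP=> y; rewrite !inE; apply/negP=> /andP[/PB[yD _ _] /FP[_]].
    by rewrite (negPf yD).
  have [_ -> _] := PP x; clear; lia.
- move=> y; have [yD|yD] := boolP (y \in D); last first.
    apply: leq_trans (Pin y yD); apply/subset_leq_card/subsetP=> x; rewrite !inE.
    move=> axy; have [xD _] := andP axy; rewrite xD.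
    by case/orP: (aN _ _ axy) => // /FP[_]; rewrite (negPf yD).
  have := Fcap y; rewrite lez_nat; apply: leq_trans.
  apply: leq_trans (leq_imset_card fst _); apply/subset_leq_card/subsetP=> x.
  rewrite inE => /aN/orP[/PB[]|xyF]; first by rewrite yD.
  by apply/imsetP; exists (x, y); rewrite // inE xyF /=.
exists setT, f; split=> //.
  split=> // x y /f_a; rewrite !inE /= => /orP[/a_e //|/a_e].
  by rewrite e_sym.
by move=> v vD; rewrite inE f_deg // inE.
Qed.
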